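(* Let $n\ge 2$, let $F$ be a field of characteristic different from two and let $G(n)=G_0\oplus G_1$ be the Grassmann algebra of rank $n$ over $F$. If $M=G_0\oplus M_1$ (with $M_1\subset G_1$) is a homogeneous maximal (with respect to inclusion) commutative subalgebra of $G(n)$, then $\nabla_M:=\{I\subseteq[n]\mid v_I\in M_1\}$ is a maximal commutative algebraic system. Moreover, if $T$ is a maximal commutative algebraic system in $[n]$ and $M_T:=\mathrm{span}_F\{v_I\mid I\in T\}$, then $G_0\oplus M_T$ is a maximal commutative subalgebra of $G(n)$.
   Context: Write $[n]=\{1,\dots,n\}$. The Grassmann algebra $G(n)$ over a field $F$ of characteristic $\ne 2$ is the unital associative $F$-algebra generated by $v_1,\dots,v_n$ subject to $v_iv_j=-v_jv_i$ for all $1\le i,j\le n$ (so $v_i^2=0$). For $I=\{i_1<\dots<i_k\}\subseteq[n]$ put $v_I=v_{i_1}\cdots v_{i_k}$ ($v_\emptyset=1$); the $v_I$ form a basis of $G(n)$, which has dimension $2^n$. $G_0$ is the span of the $v_I$ with $|I|$ even and $G_1$ is the span of the $v_I$ with $|I|$ odd. A subalgebra is homogeneous if it is spanned by monomials $v_I$. A maximal commutative subalgebra $M$ contains $G_0$ and can be written $M=G_0\oplus M_1$ with $M_1\subset G_1$. A nonempty collection $\Delta$ of subsets of $[n]$ of odd size is an algebraic system if for every $A_1\subseteq[n]$ with $|A_1|$ even and every $A_2\in\Delta$ with $A_1\cap A_2=\emptyset$ we have $A_1\cup A_2\in\Delta$. It is commutative if any two elements of $\Delta$ have nonempty intersection.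 A commutative system $\Delta$ is maximal if for every $A\subseteq[n]$ with $|A|$ odd and $A\notin\Delta$ there is $B\in\Delta$ with $A\cap B=\emptyset$. A maximal commutative algebraic system is an algebraic system that is commutative and maximal. *)

(* Defs.v *)
From HB Require Import structures.
From mathcomp Require Import all_boot all_order all_algebra all_field.

Set Implicit Arguments.
Unset Strict Implicit.
Unset Printing Implicit Defensive.

Import GRing.Theory.
Local Open Scope ring_scope.

(* [n] = {1, ..., n} is represented by 'I_n = {0, ..., n - 1}.                *)

(* The Grassmann algebra G(n) over F is realised on the free vector space     *)
(* with basis the subsets of [n], the basis vector gdelta I standing for the  *)
(* increasing product v_I. The lemmas grassmann_anticomm, gmonE and           *)
(* grassmann_univ below show that this is the algebra presented by generators *)
(* v_i and relations v_i v_j = - v_j v_i in characteristic different from 2.  *)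

Definition inversions n (J K : {set 'I_n}) : nat :=
  (\sum_(j in J) \sum_(k in K) (k < j)%N)%N.

Definition grassmann (F : fieldType) (n : nat) : Type :=
  {ffun {set 'I_n} -> F^o}.

Section Construction.

Variables (F : fieldType) (n : nat).
Implicit Types I J K L : {set 'I_n}.

#[warning="-redundant-canonical-projection"]
HB.instance Definition _ := Vector.copy (grassmann F n)
  {ffun {set 'I_n} -> F^o}.

Local Notation G := (grassmann F n).

(* v_J v_K = gsign J K *: v_(J :|: K) *)
Definition gsign J K : F :=
  if [disjoint J & K] then (-1) ^+ inversions J K else 0.

Definition gdelta I : G := [ffun J => (J == I)%:R].

Definition gmul (f g : G) : G :=
  \sum_J \sum_K (f J * g K * gsign J K) *: gdelta (J :|: K).

Lemma gdeltaE I J : gdelta I J = (J == I)%:R.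
Proof. by rewrite ffunE. Qed.

Lemma gsum_deltaE (f : G) : f = \sum_I f I *: gdelta I.
Proof.
apply/ffunP=> J; rewrite sum_ffunE (bigD1 J) //= big1 ?addr0.
  by rewrite ffunE gdeltaE eqxx /GRing.scale /= mulr1.
by move=> I neqIJ; rewrite ffunE gdeltaE eq_sym (negPf neqIJ) scaler0.
Qed.

Lemma gmulDl : left_distributive gmul +%R.
Proof.
move=> f g h; rewrite /gmul -big_split; apply: eq_bigr => J _ /=.
rewrite -big_split; apply: eq_bigr => K _ /=.
by rewrite ffunE !mulrDl scalerDl.
Qed.

Lemma gmulDr : right_distributive gmul +%R.
Proof.
move=> f g h; rewrite /gmul -big_split; apply: eq_bigr => J _ /=.
rewrite -big_split; apply: eq_bigr => K _ /=.
by rewrite ffunE mulrDr mulrDl scalerDl.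
Qed.

Lemma gmulZl a f g : a *: gmul f g = gmul (a *: f) g.
Proof.
rewrite /gmul scaler_sumr; apply: eq_bigr => J _.
rewrite scaler_sumr; apply: eq_bigr => K _.
by rewrite scalerA ffunE !mulrA.
Qed.

Lemma gmulZr a f g : a *: gmul f g = gmul f (a *: g).
Proof.
rewrite /gmul scaler_sumr; apply: eq_bigr => J _.
rewrite scaler_sumr; apply: eq_bigr => K _.
by rewrite scalerA ffunE !mulrA [a * _]mulrC.
Qed.

Lemma gmul_delta J K : gmul (gdelta J) (gdelta K) = gsign J K *: gdelta (J :|: K).
Proof.
rewrite /gmul (bigD1 J) //= [X in _ + X]big1 ?addr0 => [|J' neqJ].
  rewrite (bigD1 K) //= [X in _ + X]big1 ?addr0 => [|K' neqK].
    by rewrite !gdeltaE !eqxx !mul1r.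
  by rewrite [gdelta K _]gdeltaE (negPf neqK) mulr0 mul0r scale0r.
by apply: big1 => K' _; rewrite gdeltaE (negPf neqJ) !mul0r scale0r.
Qed.

Lemma gmul0l g : gmul 0 g = 0.
Proof. by rewrite -[in LHS](scale0r (0 : G)) -gmulZl scale0r. Qed.

Lemma gmul0r g : gmul g 0 = 0.
Proof. by rewrite -[in LHS](scale0r (0 : G)) -gmulZr scale0r. Qed.

Lemma gmul_suml (T : Type) (r : seq T) (P : pred T) (E : T -> G) g :
  gmul (\sum_(i <- r | P i) E i) g = \sum_(i <- r | P i) gmul (E i) g.
Proof. by apply: (big_morph (gmul^~ g) (fun x y => gmulDl x y g) (gmul0l g)). Qed.

Lemma gmul_sumr (T : Type) (r : seq T) (P : pred T) (E : T -> G) g :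
  gmul g (\sum_(i <- r | P i) E i) = \sum_(i <- r | P i) gmul g (E i).
Proof. by apply: (big_morph (gmul g) (gmulDr g) (gmul0r g)). Qed.

Lemma inversionsUl J K L : [disjoint J & K] ->
  inversions (J :|: K) L = (inversions J L + inversions K L)%N.
Proof.
move=> dJK; rewrite /inversions -bigU //.
by apply: eq_bigl => x; rewrite !inE.
Qed.

Lemma inversionsUr J K L : [disjoint K & L] ->
  inversions J (K :|: L) = (inversions J K + inversions J L)%N.
Proof.
move=> dKL; rewrite /inversions -big_split; apply: eq_bigr => j _ /=.
by rewrite -bigU //; apply: eq_bigl => x; rewrite !inE.
Qed.

Lemma gsign_cocycle J K L :
  gsign J K * gsign (J :|: K) L = gsign K L * gsign J (K :|: L).
Proof.
rewrite /gsign -![[disjoint _ & _ :|: _]]setI_eq0 -![[disjoint _ :|: _ & _]]setI_eq0.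
rewrite setIUl setIUr !setU_eq0 !setI_eq0.
have [dJK|] := boolP [disjoint J & K]; have [dKL|] := boolP [disjoint K & L];
  rewrite ?(andbF, andbT, mul0r, mulr0) //=.
case: ifP => dJL; rewrite ?mulr0 //.
by rewrite -!exprD inversionsUl // inversionsUr // addnA [in RHS]addnC.
Qed.

Lemma gsign0l K : gsign set0 K = 1.
Proof. by rewrite /gsign -setI_eq0 set0I eqxx /inversions big_set0. Qed.

Lemma gsign0r K : gsign K set0 = 1.
Proof.
rewrite /gsign -setI_eq0 setI0 eqxx /inversions big1 // => j _.
by rewrite big_set0.
Qed.

Lemma gmulA : associative gmul.
Proof.
have deltaA J K L : gmul (gdelta J) (gmul (gdelta K) (gdelta L)) =
    gmul (gmul (gdelta J) (gdelta K)) (gdelta L).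
  rewrite !gmul_delta -gmulZl -gmulZr !gmul_delta !scalerA setUA.
  by rewrite gsign_cocycle.
move: gmul gmulZl gmulZr gmul_suml gmul_sumr deltaA => m Zl Zr suml sumr dA f g h.
rewrite (gsum_deltaE f) !suml; apply: eq_bigr => J _.
rewrite (gsum_deltaE g) suml !sumr suml; apply: eq_bigr => K _.
rewrite (gsum_deltaE h) !sumr; apply: eq_bigr => L _.
by rewrite -!(Zl, Zr) dA !scalerA -[h L * _ * _]mulrA [h L * _]mulrC.
Qed.

Lemma gmul1l : left_id (gdelta set0) gmul.
Proof.
move=> f; rewrite {1}(gsum_deltaE f) gmul_sumr [RHS]gsum_deltaE.
by apply: eq_bigr => J _; rewrite -gmulZr gmul_delta gsign0l scale1r set0U.
Qed.

Lemma gmul1r : right_id (gdelta set0) gmul.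
Proof.
move=> f; rewrite {1}(gsum_deltaE f) gmul_suml [RHS]gsum_deltaE.
by apply: eq_bigr => J _; rewrite -gmulZl gmul_delta gsign0r scale1r setU0.
Qed.

Lemma gone_neq0 : gdelta set0 != 0.
Proof.
by apply/eqP=> /ffunP/(_ set0)/eqP; rewrite gdeltaE eqxx ffunE oner_eq0.
Qed.

HB.instance Definition _ := GRing.Zmodule_isNzRing.Build G
  gmulA gmul1l gmul1r gmulDl gmulDr gone_neq0.
HB.instance Definition _ := GRing.Lmodule_isLalgebra.Build F G gmulZl.
HB.instance Definition _ := GRing.Lalgebra_isAlgebra.Build F G gmulZr.
HB.instance Definition _ := Algebra_isFalgebra.Build F G.

Definition gvar (i : 'I_n) : G := gdelta [set i].

(* The factors are multiplied in increasing order of the indices. *)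
Definition gmon I : G := \prod_(i in I) gvar i.

End Construction.

Section AnticommutingFamily.

Variables (F : fieldType) (A : algType F) (n : nat) (a : 'I_n -> A).
Implicit Types I J K : {set 'I_n}.
Hypothesis anti_a : forall i j, a i * a j = - (a j * a i).
Hypothesis sqr_a : forall i, a i * a i = 0.

Lemma mul_prod_sorted i J (s : seq 'I_n) :
  sorted (fun x y : 'I_n => (x < y)%N) s -> i \in s ->
  a i * \prod_(j <- s | j \in J) a j =
  if i \in J then 0 else
    (-1) ^+ (\sum_(j <- s | j \in J) (j < i)%N) *: \prod_(j <- s | j \in i |: J) a j.
Proof.
have ltT : transitive (fun x y : 'I_n => (x < y)%N).
  by move=> y x z; apply: ltn_trans.
elim: s => // x s IHs /= xs; rewrite inE !big_cons.
case: eqVneq xs => [<-|neq_ix] xs /= => [_|s_i].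
  have/allP lt_is := order_path_min ltT xs.
  case: ifP => [_|NJi]; first by rewrite mulrA sqr_a mul0r.
  have -> : (\sum_(j <- s | j \in J) (j < i) = 0)%N.
    rewrite big_seq_cond big1 // => j /andP[/lt_is lt_ij _].
    by apply/eqP; rewrite eqb0 -leqNgt ltnW.
  rewrite setU11 expr0 scale1r; congr (_ * _).
  rewrite big_seq_cond [RHS]big_seq_cond; apply: eq_bigl => j; rewrite !inE.
  by case: eqVneq => // ->; have [/lt_is|//] := boolP (i \in s); rewrite ltnn.
have lt_xi : (x < i)%N by apply: (allP (order_path_min ltT xs)).
have {}IHs := IHs (path_sorted xs) s_i.
have -> : (x \in i |: J) = (x \in J) by rewrite !inE eq_sym (negPf neq_ix).
case: (x \in J); last by [].
rewrite mulrA anti_a mulNr -mulrA IHs; case: (i \in J); first by rewrite mulr0 oppr0.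
by rewrite lt_xi add1n exprS -scalerAr mulN1r scaleNr.
Qed.

Lemma mul_prod_set i J :
  a i * \prod_(j in J) a j =
  gsign F [set i] J *: \prod_(j in i |: J) a j.
Proof.
rewrite mul_prod_sorted ?mem_index_enum //; last first.
  have := iota_ltn_sorted 0 n; rewrite -val_enum_ord sorted_map.
  by rewrite enumT /index_enum.
rewrite /gsign -setI_eq0 /inversions big_set1.
have [Ji|NJi] := boolP (i \in J).
  by rewrite (setIidPl _) ?sub1set // -cards_eq0 cards1 scale0r.
by rewrite setI_eq0 disjoints1 NJi.
Qed.

Lemma mul_prod_sets I J :
  (\prod_(i in I) a i) * (\prod_(j in J) a j) =
  gsign F I J *: \prod_(j in I :|: J) a j.
Proof.
have [m leIm] := ubnP #|I|; elim: m I leIm J => // m IHm I leIm J.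
have [->|[i Ii]] := set_0Vmem I.
  by rewrite big_set0 mul1r gsign0l scale1r set0U.
pose I' := I :\ i; have defI : i |: I' = I by rewrite setD1K.
have ltI'm : (#|I'| < m)%N.
  by move: leIm; rewrite ltnS (cardsD1 i) Ii.
have n0 : gsign F [set i] I' != 0.
  by rewrite /gsign disjoints1 !inE eqxx signr_eq0.
apply: (can_inj (scalerK n0)); rewrite scalerAl -{1}defI -mul_prod_set -mulrA.
rewrite IHm // -scalerAr mul_prod_set !scalerA setUA defI.
by rewrite -gsign_cocycle defI.
Qed.

Definition glift (x : grassmann F n) : A := \sum_I x I *: \prod_(i in I) a i.

Lemma glift_delta I : glift (gdelta F I) = \prod_(i in I) a i.
Proof.
rewrite /glift (bigD1 I) //= [X in _ + X]big1 ?addr0 => [|J neqJI].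
  by rewrite gdeltaE eqxx scale1r.
by rewrite gdeltaE (negPf neqJI) scale0r.
Qed.

Lemma glift_linear : linear glift.
Proof.
move=> c x y; rewrite /glift scaler_sumr -big_split; apply: eq_bigr => I _ /=.
by rewrite !ffunE scalerDl scalerA.
Qed.

HB.instance Definition _ :=
  GRing.isLinear.Build F (grassmann F n) A _ glift glift_linear.

Lemma glift_monoid_morphism : monoid_morphism glift.
Proof.
split=> [|x y]; first by rewrite [1]/(gdelta F set0) glift_delta big_set0.
rewrite [x * y]/(gmul x y) /gmul linear_sum /= [glift x]/glift mulr_suml.
apply: eq_bigr => J _; rewrite linear_sum /= [glift y]/glift mulr_sumr.
apply: eq_bigr => K _; rewrite linearZ /= glift_delta -scalerAr.
rewrite -(scalerAl (x J) (\prod_(i in J) a i)) mul_prod_sets !scalerA.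
by rewrite [y K * x J]mulrC.
Qed.

End AnticommutingFamily.

Section Presentation.

Variables (F : fieldType) (n : nat).

Lemma grassmann_anticomm (i j : 'I_n) : gvar F i * gvar F j = - (gvar F j * gvar F i).
Proof.
rewrite /GRing.mul /= !gmul_delta [in RHS]setUC -scaleNr /gsign !disjoints1 !inE.
rewrite /inversions !big_set1 -!val_eqE /=.
by case: ltngtP => _ /=; rewrite ?opprK ?oppr0.
Qed.

Lemma gvar_sqr (i : 'I_n) : gvar F i * gvar F i = 0.
Proof. by rewrite /GRing.mul /= gmul_delta /gsign disjoints1 inE eqxx scale0r. Qed.

Lemma gmonE (I : {set 'I_n}) : gmon F I = gdelta F I.
Proof.
have [m leIm] := ubnP #|I|; elim: m I leIm => // m IHm I leIm.
have [->|[i Ii]] := set_0Vmem I; first by rewrite /gmon big_set0.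
have n0 : gsign F [set i] (I :\ i) != 0.
  by rewrite /gsign disjoints1 !inE eqxx signr_eq0.
apply: (can_inj (scalerK n0)); rewrite -{2 4}(setD1K Ii) -gmul_delta /gmon.
rewrite -(mul_prod_set grassmann_anticomm gvar_sqr) -/(gmon _ _) IHm //.
by move: leIm; rewrite ltnS (cardsD1 i) Ii.
Qed.

Lemma grassmann_univ (charF : 2 \notin [pchar F]) (A : algType F) (a : 'I_n -> A) :
  (forall i j, a i * a j = - (a j * a i)) ->
  exists f : {lrmorphism grassmann F n -> A},
    (forall i, f (gvar F i) = a i) /\
    (forall g : {lrmorphism grassmann F n -> A},
       (forall i, g (gvar F i) = a i) -> g =1 f).
Proof.
move=> anti_a; have sqr_a i : a i * a i = 0.
  have two_neq0 : 2%:R != 0 :> F by move: charF; rewrite inE.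
  apply: (can_inj (scalerK two_neq0)); rewrite scaler0 scaler_nat mulr2n.
  by rewrite {1}anti_a addNr.
pose M := GRing.isMonoidMorphism.Build _ _ _ (glift_monoid_morphism anti_a sqr_a).
pose f : {lrmorphism grassmann F n -> A} := HB.pack (glift a) M.
exists f; split=> [i|g gE x]; first by rewrite /= glift_delta big_set1.
rewrite {1}(gsum_deltaE x) linear_sum; apply: eq_bigr => I _ /=.
rewrite linearZ /= -gmonE rmorph_prod; congr (_ *: _).
by apply: eq_bigr => i _; apply: gE.
Qed.

End Presentation.

Section Subalgebras.

Variables (F : fieldType) (n : nat).
Local Notation G := (grassmann F n).
Implicit Types (M N : {vspace G}) (T : {set {set 'I_n}}).

(* Unlike {aspace G}, this requires the unit of M to be 1 : G. *)
Definition subalgebra M : Prop := 1 \in M /\ (M * M <= M)%VS.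

Definition commutative_subalgebra M : Prop :=
  subalgebra M /\ {in M &, commutative (@GRing.mul G)}.

Definition maximal_commutative_subalgebra M : Prop :=
  commutative_subalgebra M /\
  forall N, commutative_subalgebra N -> (M <= N)%VS -> N = M.

Definition gspan T : {vspace G} := <<[seq gmon F J | J in T]>>%VS.

Definition homogeneous M : Prop := exists T, M = gspan T.

Definition G_even : {vspace G} := gspan [set J : {set 'I_n} | ~~ odd #|J|].
Definition G_odd : {vspace G} := gspan [set J : {set 'I_n} | odd #|J|].

Definition nabla M : {set {set 'I_n}} := [set J | gmon F J \in M].

End Subalgebras.

Section Systems.

Variable n : nat.
Implicit Types (A B : {set 'I_n}) (D : {set {set 'I_n}}).

Definition algebraic_system D : Prop :=
  [/\ D != set0,
      {in D, forall A, odd #|A|}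
    & forall A1 A2, ~~ odd #|A1| -> A2 \in D -> A1 :&: A2 = set0 ->
        A1 :|: A2 \in D].

Definition commutative_system D : Prop :=
  {in D &, forall A B, A :&: B != set0}.

Definition maximal_system D : Prop :=
  forall A, odd #|A| -> A \notin D -> exists2 B, B \in D & A :&: B = set0.

Definition maximal_commutative_algebraic_system D : Prop :=
  [/\ algebraic_system D, commutative_system D & maximal_system D].

End Systems.

(* Main.v *)
Require Import Defs.
From mathcomp Require Import all_boot all_order all_algebra all_field.

(** Everything is read off coordinates in the monomial basis [v_I].

    A homogeneous subspace containing the even part is the span of the family
    [even_with D] of all even sets together with some family [D] of odd sets.
    For disjoint [J] and [K] one has [v_J v_K = ± v_(J :|: K)], and swapping
    the factors multiplies the sign by [(-1) ^ (#|J| * #|K|)]; if [J] and [K]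
    meet, both products vanish. Hence the span is closed under products
    exactly when [even_with D] is closed under disjoint unions, which is the
    defining property of an algebraic system, and the product on it is
    commutative exactly when no two members of [D] are disjoint
    ([gspan_subalgebra], [gspan_commutative], [commute_coord0]).

    The two notions of maximality are matched as follows. If an odd [A] outside
    [D] meets every member of [D], then [D] together with all the sets
    [A :|: E], [E] even and disjoint from [A], is again closed and
    intersecting, so it spans a larger commutative subalgebra; a maximal
    subalgebra thus gives a maximal system ([adjoin]). Conversely, let [T] be
    a maximal system and [x] an element of a commutative subalgebra containing
    the span of [even_with T], where [x] need not lie in a homogeneous
    subspace. An odd [A] outside [T] is disjoint from some [B] in [T], and
    comparing the coordinates of [x v_B] and [v_B x] at [A :|: B] gives
    [2 x_A = 0] ([commute_coord0]); so [x] lies in the span already. *)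

Set Implicit Arguments.
Unset Strict Implicit.
Unset Printing Implicit Defensive.

Import GRing.Theory.
Local Open Scope ring_scope.

(** * Set families closed under disjoint unions *)

Section Families.

Variable n : nat.
Implicit Types (A B E J K : {set 'I_n}) (D S : {set {set 'I_n}}).

Definition even_with D : {set {set 'I_n}} := [set J : {set 'I_n} | odd #|J| ==> (J \in D)].

Definition disjoint_union_closed S : Prop :=
  {in S &, forall J K, [disjoint J & K] -> J :|: K \in S}.

(** Separated from the other axioms of an algebraic system because it is also
    applied to the family of a subalgebra before that family is known to be
    nonempty. *)
Definition even_union_closed D : Prop :=
  forall E A, ~~ odd #|E| -> A \in D -> E :&: A = set0 -> E :|: A \in D.

Lemma odd_card_disjointU J K :
  [disjoint J & K] -> odd #|J :|: K| = odd #|J| (+) odd #|K|.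
Proof. by rewrite -setI_eq0 => /eqP dJK; rewrite cardsU dJK cards0 subn0 oddD. Qed.

Lemma even_with_closed D :
  even_union_closed D -> disjoint_union_closed (even_with D).
Proof.
move=> clD J K; rewrite !inE => hJ hK dJK; rewrite odd_card_disjointU //.
have dJK0 : J :&: K = set0 by apply/eqP; rewrite setI_eq0.
case oJ: (odd #|J|) hJ => /= hJ; case oK: (odd #|K|) hK => //= hK.
  by rewrite setUC; apply: clD; rewrite ?oK // setIC.
by apply: clD; rewrite ?oJ.
Qed.

(** The sets that closure forces into an algebraic system once it contains
    [D] and [A]. *)
Definition adjoin A D : {set {set 'I_n}} :=
  D :|: [set J : {set 'I_n} | (A \subset J) && odd #|J|].

Lemma adjoin_closed A D :
  even_union_closed D -> even_union_closed (adjoin A D).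
Proof.
move=> clD E B evE; rewrite !inE => /orP[DB|/andP[sAB oB]] dEB.
  by rewrite clD.
apply/orP; right; rewrite (subset_trans sAB) ?subsetUr //=.
by rewrite odd_card_disjointU -?setI_eq0 ?dEB // (negPf evE).
Qed.

Lemma adjoin_commutative A D : odd #|A| ->
  commutative_system D -> {in D, forall B, A :&: B != set0} ->
  commutative_system (adjoin A D).
Proof.
move=> oA cD mA.
have meet B J : A :&: B != set0 -> A \subset J -> B :&: J != set0.
  move=> nAB sAJ; apply: contraNneq nAB => BJ0.
  by rewrite -subset0 -BJ0 setIC setIS.
(* An odd set is nonempty, so two supersets of A meet in A. *)
have nA : A != set0 by apply: contraTneq oA => ->; rewrite cards0.
move=> B C; rewrite !inE => /orP[DB|/andP[sAB _]] /orP[DC|/andP[sAC _]].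
- exact: cD.
- exact: meet (mA B DB) sAC.
- by rewrite setIC; apply: meet (mA C DC) sAB.
- by apply: meet sAC; rewrite (setIidPl sAB).
Qed.

End Families.

(** * Spans of monomials and their coordinates *)

Section Spans.

Variables (F : fieldType) (n : nat).
Local Notation G := (grassmann F n).
Implicit Types (A B I J K : {set 'I_n}) (D S T : {set {set 'I_n}}) (x y : G).

Lemma coord_scale_gmon (c : F) I J : (c *: gmon F I) J = c * (J == I)%:R.
Proof. by rewrite ffunE gmonE gdeltaE. Qed.

Lemma mem_gspanP S x : reflect (forall J, J \notin S -> x J = 0) (x \in gspan F S).
Proof.
apply: (iffP idP) => [Sx J NSJ | x0].
  have [c ->] : exists c : {set 'I_n} -> F, x = \sum_(I in S) c I *: gmon F I.
    have Ss : (gspan F S <= \sum_(I in S) <[gmon F I]>)%VS.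
      apply/span_subvP => _ /imageP[I SI ->].
      by rewrite (subvP (sumv_sup I SI (subvv _))) ?memv_line.
    have /memv_sumP[y ly ->] := subvP Ss x Sx.
    exists (fun I => y I I); apply: eq_bigr => I /ly/vlineP[k ->].
    by rewrite !coord_scale_gmon eqxx mulr1.
  rewrite sum_ffunE big1 // => I SI; rewrite coord_scale_gmon.
  by rewrite (_ : J == I = false) ?mulr0 //; apply: contraNF NSJ => /eqP->.
rewrite (gsum_deltaE x); apply: memv_suml => J _.
have [SJ|/x0->] := boolP (J \in S); last by rewrite scale0r mem0v.
by rewrite -gmonE memvZ // memv_span // image_f.
Qed.

Lemma gmon_gspan S J : (gmon F J \in gspan F S) = (J \in S).
Proof.
apply/mem_gspanP/idP => [mS | SJ I].
  apply: contraT => /mS/eqP.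
  by rewrite gmonE gdeltaE eqxx oner_eq0.
by rewrite gmonE gdeltaE; case: eqVneq => // ->; rewrite SJ.
Qed.

Lemma gspanU S T : (gspan F S + gspan F T)%VS = gspan F (S :|: T).
Proof.
apply/eqP; rewrite eqEsubv subv_add; apply/andP; split.
  by apply/andP; split; apply/subvP => x /mem_gspanP x0; apply/mem_gspanP => J;
    rewrite inE negb_or => /andP[NSJ NTJ]; apply: x0.
apply/span_subvP => _ /imageP[J STJ ->]; move: STJ; rewrite inE.
case/orP => ?; [apply: (subvP (addvSl _ _)) | apply: (subvP (addvSr _ _))];
by rewrite gmon_gspan.
Qed.

Lemma G_even_add_gspan D : (G_even F n + gspan F D)%VS = gspan F (even_with D).
Proof.
rewrite /G_even gspanU; apply: congr1.
by apply/setP=> J; rewrite !inE implybE.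
Qed.

Lemma even_cap_odd x : x \in G_even F n -> x \in G_odd F n -> x = 0.
Proof.
move=> /mem_gspanP ev /mem_gspanP od; apply/ffunP => J; rewrite ffunE.
by have [oJ|eJ] := boolP (odd #|J|); [apply: ev | apply: od]; rewrite inE ?negbK.
Qed.

(** * Products of monomials *)

Lemma gsign_neq0 J K : (gsign F J K != 0) = [disjoint J & K].
Proof. by rewrite /gsign; case: ifP; rewrite ?signr_eq0 ?eqxx. Qed.

(** Each of the [#|J| * #|K|] pairs is an inversion in exactly one order. *)
Lemma inversions_swap J K : [disjoint J & K] ->
  (inversions J K + inversions K J = #|J| * #|K|)%N.
Proof.
move=> dJK; rewrite /inversions [X in (_ + X)%N]exchange_big -big_split /=.
rewrite -sum_nat_const; apply: eq_bigr => j Jj; rewrite -big_split /= -sum1_card.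
apply: eq_bigr => k Kk; have := disjointFr dJK Jj.
by case: ltngtP => // /val_inj ejk; rewrite -ejk Kk.
Qed.

Lemma gsign_swap J K : gsign F K J = (-1) ^+ (#|J| * #|K|) * gsign F J K.
Proof.
rewrite /gsign [X in if X then _ else _]disjoint_sym.
case: ifP => dJK; last by rewrite mulr0.
rewrite -inversions_swap // addnC exprD -mulrA -exprD addnn -muln2 exprM.
by rewrite sqrr_sign mulr1.
Qed.

Lemma gmonM J K : gmon F J * gmon F K = gsign F J K *: gmon F (J :|: K).
Proof. by rewrite !gmonE; apply: gmul_delta. Qed.

Lemma gspan_subalgebra S :
  set0 \in S -> disjoint_union_closed S -> subalgebra (gspan F S).
Proof.
move=> S0 clS; split; first by rewrite -gmon_gspan gmonE in S0.
apply/prodvP => x y /mem_gspanP x0 /mem_gspanP y0.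
rewrite [x * y]/(gmul x y) /gmul.
apply: memv_suml => J _; apply: memv_suml => K _.
have [SJ|/x0->] := boolP (J \in S); last by rewrite !mul0r scale0r mem0v.
have [SK|/y0->] := boolP (K \in S); last by rewrite mulr0 mul0r scale0r mem0v.
have [s0|] := eqVneq (gsign F J K) 0; first by rewrite s0 mulr0 scale0r mem0v.
by rewrite gsign_neq0 => dJK; rewrite memvZ // -gmonE gmon_gspan clS.
Qed.

(** The sign relating the two orders is [-1] only when both sets are odd; two
    odd members of [S] meet, so then both products vanish. *)
Lemma gspan_commutative S :
  {in S &, forall J K, odd #|J| -> odd #|K| -> J :&: K != set0} ->
  {in gspan F S &, commutative (@GRing.mul G)}.
Proof.
move=> meetS x y /mem_gspanP x0 /mem_gspanP y0.
rewrite [x * y]/(gmul x y) [y * x]/(gmul y x) /gmul [RHS]exchange_big.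
apply: eq_bigr => J _; apply: eq_bigr => K _ /=; rewrite setUC.
congr (_ *: _); rewrite [y K * _]mulrC.
have [SJ|/x0->] := boolP (J \in S); last by rewrite !mul0r.
have [SK|/y0->] := boolP (K \in S); last by rewrite mulr0 !mul0r.
congr (_ * _); rewrite gsign_swap -signr_odd oddM.
case: andP => [[oJ oK]|_]; last by rewrite mul1r.
apply/eqP; have := meetS J K SJ SK oK oJ; rewrite setI_eq0 -gsign_neq0 negbK.
by rewrite [gsign F J K]gsign_swap mulf_eq0 signr_eq0 /= => /eqP->; rewrite mulr0.
Qed.

(** Among the monomials [v_J], only [v_A] contributes to the coordinate at
    [A :|: B] of a product with [v_B]. *)
Lemma disjoint_unionI A B J : [disjoint A & B] ->
  [disjoint J & B] -> A :|: B = J :|: B -> J = A.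
Proof.
move=> dAB dJB /setP eU; apply/setP => i; have := eU i; rewrite !inE.
have [Bi|_] := boolP (i \in B); last by rewrite !orbF.
by rewrite (disjointFl dAB Bi) (disjointFl dJB Bi).
Qed.

Lemma coord_mul_gmon x A B : [disjoint A & B] ->
  (x * gmon F B) (A :|: B) = x A * gsign F A B.
Proof.
move=> dAB; rewrite [in LHS](gsum_deltaE x) mulr_suml.
rewrite sum_ffunE (bigD1 A) //= big1 ?addr0 => [|J neqJA].
  by rewrite -scalerAl -gmonE gmonM scalerA coord_scale_gmon eqxx mulr1.
rewrite -scalerAl -gmonE gmonM scalerA coord_scale_gmon.
have [s0|] := eqVneq (gsign F J B) 0; first by rewrite s0 mulr0 mul0r.
rewrite gsign_neq0 => dJB; case: eqVneq => [eU|_]; last by rewrite mulr0.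
by rewrite (disjoint_unionI dAB dJB eU) eqxx in neqJA.
Qed.

Lemma coord_gmon_mul x A B : [disjoint A & B] ->
  (gmon F B * x) (A :|: B) = x A * gsign F B A.
Proof.
move=> dAB; rewrite [in LHS](gsum_deltaE x) mulr_sumr.
rewrite sum_ffunE (bigD1 A) //= big1 ?addr0 => [|J neqJA].
  rewrite -scalerAr -gmonE gmonM scalerA coord_scale_gmon [B :|: A]setUC.
  by rewrite eqxx mulr1.
rewrite -scalerAr -gmonE gmonM scalerA coord_scale_gmon.
have [s0|] := eqVneq (gsign F B J) 0; first by rewrite s0 mulr0 mul0r.
rewrite gsign_neq0 disjoint_sym [B :|: J]setUC => dJB.
case: eqVneq => [eU|_]; last by rewrite mulr0.
by rewrite (disjoint_unionI dAB dJB eU) eqxx in neqJA.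
Qed.

(** The coordinates of [x v_B] and [v_B x] at [A :|: B] are [x_A] with opposite
    signs. This is where characteristic 2 must be excluded. *)
Lemma commute_coord0 x A B : 2%N \notin [pchar F] ->
  odd #|A| -> odd #|B| -> [disjoint A & B] ->
  x * gmon F B = gmon F B * x -> x A = 0.
Proof.
rewrite inE /= => two_neq0 oA oB dAB cxB.
have := coord_mul_gmon x dAB; rewrite cxB coord_gmon_mul //.
rewrite gsign_swap -signr_odd oddM oA oB expr1 mulN1r mulrN => /eqP.
rewrite eq_sym -addr_eq0 -mulr2n -mulr_natl !mulf_eq0 (negPf two_neq0) /=.
by rewrite (negPf (_ : gsign F A B != 0)) ?gsign_neq0 // orbF => /eqP.
Qed.

Lemma subalgebra_gmonU (M : {vspace G}) J K : subalgebra M ->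
  gmon F J \in M -> gmon F K \in M -> [disjoint J & K] -> gmon F (J :|: K) \in M.
Proof.
case=> _ /prodvP MM MJ MK dJK; have := MM _ _ MJ MK.
rewrite gmonM => MJK; rewrite -gsign_neq0 in dJK.
by rewrite -[gmon F _](scalerK dJK) memvZ.
Qed.

(** * The correspondence *)

(** Applied both to a maximal system and to the enlarged family [adjoin A D]
    that tests the maximality of a subalgebra. *)
Lemma even_with_commutative_subalgebra D :
  even_union_closed D -> commutative_system D ->
  commutative_subalgebra (gspan F (even_with D)).
Proof.
move=> clD cD; split.
  by apply: gspan_subalgebra (even_with_closed clD); rewrite inE cards0.
apply: gspan_commutative => J K; rewrite !inE => hJ hK oJ oK.
by apply: cD; [move: hJ; rewrite oJ | move: hK; rewrite oK].
Qed.

Section FromSubalgebra.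

Variable M1 : {vspace G}.
Hypothesis M1_odd : (M1 <= G_odd F n)%VS.
Local Notation M := (G_even F n + M1)%VS.

Lemma mem_nabla_odd J : J \in nabla M1 -> odd #|J|.
Proof. by rewrite inE => /(subvP M1_odd); rewrite gmon_gspan inE. Qed.

(** In the decomposition of an odd monomial along [G_even + M1], the even
    component is also odd, hence zero. *)
Lemma mem_nabla J : odd #|J| -> (J \in nabla M1) = (gmon F J \in M).
Proof.
move=> oJ; rewrite inE; apply/idP/idP; first exact/subvP/addvSr.
case/memv_addP=> u evu [w M1w eJ]; suff u0 : u = 0 by rewrite eJ u0 add0r.
apply: even_cap_odd evu _; rewrite -(addrK w u) -eJ.
by rewrite rpredB ?gmon_gspan ?inE // (subvP M1_odd).
Qed.

Lemma homogeneousE : homogeneous M -> M = gspan F (even_with (nabla M1)).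
Proof.
case=> S eM; rewrite {1}eM; apply: congr1; apply/setP=> J.
rewrite -(gmon_gspan S) -eM inE.
have [oJ|eJ] := boolP (odd #|J|); first by rewrite mem_nabla.
by apply/(subvP (addvSl _ _)); rewrite gmon_gspan inE.
Qed.

Lemma nabla_closed : subalgebra M -> even_union_closed (nabla M1).
Proof.
move=> algM E A evE DA EA0; have dEA : [disjoint E & A] by rewrite -setI_eq0 EA0.
have oA := mem_nabla_odd DA.
rewrite mem_nabla ?odd_card_disjointU ?(negPf evE) //.
apply: subalgebra_gmonU => //; last by rewrite -mem_nabla.
by apply/(subvP (addvSl _ _)); rewrite gmon_gspan inE.
Qed.

Lemma nabla_commutative : 2%N \notin [pchar F] ->
  {in M &, commutative (@GRing.mul G)} -> commutative_system (nabla M1).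
Proof.
move=> charF cM A B DA DB; apply/negP; rewrite setI_eq0 => dAB.
have [oA oB] := (mem_nabla_odd DA, mem_nabla_odd DB).
rewrite mem_nabla // in DA; rewrite mem_nabla // in DB.
have /eqP := commute_coord0 charF oA oB dAB (cM _ _ DA DB).
by rewrite gmonE gdeltaE eqxx oner_eq0.
Qed.

Lemma nabla_maximal : 2%N \notin [pchar F] ->
  homogeneous M -> maximal_commutative_subalgebra M -> maximal_system (nabla M1).
Proof.
move=> charF homM [[algM cM] maxM] A oA NDA.
have [/exists_inP[B DB /eqP dAB]|] := boolP [exists B in nabla M1, A :&: B == set0].
  by exists B.
rewrite negb_exists_in => /forall_inP meetA; case/negP: NDA.
have cN : commutative_subalgebra (gspan F (even_with (adjoin A (nabla M1)))).
  apply: even_with_commutative_subalgebra.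
    exact/adjoin_closed/nabla_closed.
  exact/adjoin_commutative/meetA/nabla_commutative.
rewrite mem_nabla // -(maxM _ cN) ?gmon_gspan ?inE ?subxx ?oA ?orbT //.
rewrite (homogeneousE homM); apply/span_subvP => _ /imageP[J DJ ->].
by move: DJ; rewrite gmon_gspan !inE; case: (odd _) => //= ->.
Qed.

(** With [0 < n] there is an odd set, so that the empty family is not maximal:
    nonemptiness of the system follows from maximality. *)
Lemma nabla_system : (0 < n)%N -> 2%N \notin [pchar F] ->
  homogeneous M -> maximal_commutative_subalgebra M ->
  maximal_commutative_algebraic_system (nabla M1).
Proof.
move=> n_gt0 charF homM maxM; have [[algM cM] _] := maxM.
have maxD := nabla_maximal charF homM maxM.
split=> //; last exact: nabla_commutative.
split; [| exact: mem_nabla_odd | exact: nabla_closed].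
apply/set0Pn; pose A := [set Ordinal n_gt0].
have [DA|NDA] := boolP (A \in nabla M1); first by exists A.
by have [||B DB _] := maxD A; rewrite ?cards1 //; exists B.
Qed.

End FromSubalgebra.

Lemma gspan_even_odd_direct D : {in D, forall A, odd #|A|} ->
  directv (G_even F n + gspan F D)%VS.
Proof.
move=> oD; apply/directv_addP/eqP; rewrite -subv0; apply/subvP => x.
rewrite memv_cap memv0 => /andP[evx /mem_gspanP x0]; apply/eqP/even_cap_odd => //.
apply/mem_gspanP => J; rewrite inE => eJ; apply: x0.
by apply: contra eJ; apply: oD.
Qed.

Lemma system_maximal_subalgebra T : 2%N \notin [pchar F] ->
  maximal_commutative_algebraic_system T ->
  maximal_commutative_subalgebra (G_even F n + gspan F T)%VS.
Proof.
move=> charF [[_ oT clT] cT maxT]; rewrite G_even_add_gspan.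
split=> [|N [_ cN] sTN]; first exact: even_with_commutative_subalgebra.
apply/eqP; rewrite eqEsubv sTN andbT; apply/subvP => x Nx.
apply/mem_gspanP => A; rewrite inE negb_imply => /andP[oA NTA].
have [B TB dAB] := maxT A oA NTA.
apply: (commute_coord0 charF oA (oT B TB)); first by rewrite -setI_eq0 dAB.
by apply: cN => //; rewrite (subvP sTN) // gmon_gspan inE TB implybT.
Qed.

End Spans.

Theorem lemma1 (F : fieldType) (n : nat)
    (n_ge2 : (2 <= n)%N) (charF : 2%N \notin [pchar F]%R) :
  (forall M M1 : {vspace grassmann F n},
     (M1 <= G_odd F n)%VS ->
     directv (G_even F n + M1)%VS ->
     M = (G_even F n + M1)%VS ->
     homogeneous M ->
     maximal_commutative_subalgebra M ->
     maximal_commutative_algebraic_system (nabla M1)) /\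
  (forall T : {set {set 'I_n}},
     maximal_commutative_algebraic_system T ->
     directv (G_even F n + gspan F T)%VS /\
     maximal_commutative_subalgebra (G_even F n + gspan F T)%VS).
Proof.
split=> [M M1 M1_odd _ -> homM maxM | T sysT].
  exact: nabla_system (ltnW n_ge2) charF homM maxM.
split; last exact: system_maximal_subalgebra.
by case: sysT => [[_ oT _] _ _]; apply: gspan_even_odd_direct.
Qed.
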